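(* Let $A\in\mathbb{C}^{m\times n}$ and let $X_1,X_2\in\mathbb{C}^{n\times m}$ be such that $X_1\in A\{2\}$ and $X_2\in A\{1\}$. Then $A^{(E,F)}=X_1AX_2$, where $E=X_1A$ and $F=AX_1AX_2$.
   Context: $A\{1\}$ is the set of inner inverses of $A$ (matrices $Y\in\mathbb{C}^{n\times m}$ with $AYA=A$) and $A\{2\}$ is the set of outer inverses of $A$ (matrices $Y\in\mathbb{C}^{n\times m}$ with $YAY=Y$). $EF$-inverse: for $A\in\mathbb{C}^{m\times n}$, $E\in\mathbb{C}^{n\times n}$, $F\in\mathbb{C}^{m\times m}$, an $EF$-inverse of $A$ is a matrix $X\in\mathbb{C}^{n\times m}$ with $XAX=X$, $XA=E$ and $AX=F$. When it exists it is unique and is denoted $A^{(E,F)}$. The asserted equality includes the existence of $A^{(E,F)}$. (The matrix $X_1AX_2$ is called a generalized bilateral inverse of $A$.) *)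

(* Defs.v *)
From mathcomp Require Import all_boot all_order all_algebra.
From mathcomp Require Import boolp classical_sets reals.
From mathcomp Require Import complex.

Set Implicit Arguments.
Unset Strict Implicit.
Unset Printing Implicit Defensive.

Import GRing.Theory.
Local Open Scope ring_scope.
Local Open Scope classical_set_scope.

(* R : realType is the complete ordered field of real numbers, so that
   R[i] is the field of complex numbers. *)

Definition inner_inverses (R : realType) (m n : nat) (A : 'M[R[i]]_(m, n)) :
  set 'M[R[i]]_(n, m) := [set Y | A *m Y *m A = A].

Definition outer_inverses (R : realType) (m n : nat) (A : 'M[R[i]]_(m, n)) :
  set 'M[R[i]]_(n, m) := [set Y | Y *m A *m Y = Y].

Definition is_EF_inverse (R : realType) (m n : nat) (A : 'M[R[i]]_(m, n))
    (E : 'M[R[i]]_n) (F : 'M[R[i]]_m) (X : 'M[R[i]]_(n, m)) : Prop :=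
  [/\ X *m A *m X = X, X *m A = E & A *m X = F].

Lemma is_EF_inverse_unique (R : realType) (m n : nat) (A : 'M[R[i]]_(m, n))
    (E : 'M[R[i]]_n) (F : 'M[R[i]]_m) (X Y : 'M[R[i]]_(n, m)) :
  is_EF_inverse A E F X -> is_EF_inverse A E F Y -> X = Y.
Proof.
move=> [XAX XA AX] [YAY YA AY].
by rewrite -XAX -mulmxA AX -AY mulmxA XA -YA.
Qed.

(* A^(E,F): the EF-inverse of A when there is one, and the junk value 0
   otherwise; an equation about it carries information only together with
   the existence of an EF-inverse. *)
Definition EF_inverse (R : realType) (m n : nat) (A : 'M[R[i]]_(m, n))
    (E : 'M[R[i]]_n) (F : 'M[R[i]]_m) : 'M[R[i]]_(n, m) :=
  xget 0 [set X | is_EF_inverse A E F X].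

(* Main.v *)
Require Import Defs.
From mathcomp Require Import all_boot all_order all_algebra.
From mathcomp Require Import boolp classical_sets reals.
From mathcomp Require Import complex.

Local Open Scope ring_scope.

(** Write X = X1 A X2.  The inner-inverse equation A X2 A = A lets X2 A be
    absorbed on the right of A, so X A = X1 A; then X A X = (X1 A X1) A X2,
    which the outer-inverse equation X1 A X1 = X1 collapses to X.  Since A X
    is F by associativity, X is an EF-inverse, and [is_EF_inverse_unique]
    makes it the one that [EF_inverse] selects. *)

Lemma bilateral_is_EF_inverse (R : realType) (m n : nat)
    (A : 'M[R[i]]_(m, n)) (X1 X2 : 'M[R[i]]_(n, m)) :
  outer_inverses A X1 -> inner_inverses A X2 ->
  is_EF_inverse A (X1 *m A) (A *m X1 *m A *m X2) (X1 *m A *m X2).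
Proof.
rewrite /outer_inverses /inner_inverses /= => X1AX1 AX2A.
have XA : X1 *m A *m X2 *m A = X1 *m A by rewrite -!mulmxA (mulmxA A) AX2A.
by split; rewrite ?XA // !mulmxA ?X1AX1.
Qed.

Theorem theorem4p3 (R : realType) (m n : nat) (A : 'M[R[i]]_(m, n))
    (X1 X2 : 'M[R[i]]_(n, m))
    (hX1 : outer_inverses A X1) (hX2 : inner_inverses A X2) :
  let E := X1 *m A in
  let F := A *m X1 *m A *m X2 in
  (exists X : 'M[R[i]]_(n, m), is_EF_inverse A E F X) /\
  EF_inverse A E F = X1 *m A *m X2.
Proof.
move=> E F.
have XP : is_EF_inverse A E F (X1 *m A *m X2).
  exact: bilateral_is_EF_inverse.
split; first by exists (X1 *m A *m X2).
by apply: xget_unique => // Y YP; apply: is_EF_inverse_unique YP XP.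
Qed.
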